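(* There is a one-to-one correspondence between the operators of $\mathcal T^+$ and the connected components, inside $G_A$ (respectively, inside $G_B$), of the domains $\mathcal H^{\mathbf r}$ of all generations of order $r>0$. There is a one-to-one correspondence between the operators of $\mathcal T^-$ and the connected components, inside $G_{\bar A}$ (respectively, inside $G_{\bar B}$), of the domains $\mathcal H^{\mathbf r}$ of all generations of order $r>0$. In fact, for every $n\ge 0$, as $T$ ranges over all operators of $\mathcal T^+$ that are products of $n$ generators (each equal to $A$ or $B$), the domains $TH_A$, $TH_B$, $\bar T H_{\bar A}$, $\bar T H_{\bar B}$ cover all the connected components of the domain $\mathcal H^{\mathbf{n+1}}$ of the $(n+1)$-th generation belonging respectively to $G_A$, $G_B$, $G_{\bar A}$, $G_{\bar B}$.
   Context: Coordinates on the space of binary quadratic forms $f=mx^2+ny^2+kxy$: the triple $(m,n,k)$, or $K=k$, $D=m-n$, $S=m+n$; the discriminant is $\Delta=k^2-4mn=K^2+D^2-S^2$. Fix $\Delta>0$ and let $H=\{K^2+D^2-S^2=\Delta\}\subset\mathbb R^3$ (one-sheeted hyperboloid). For $L\in \mathrm{SL}(2,\mathbb Z)$, $T_L$ is the linear operator on coefficient triples sending $f$ to $f'$ with $f'(v)=f(Lv)$. $\mathcal T=\{T_L\}\cong \mathrm{PSL}(2,\mathbb Z)$. In coordinates $(m,n,k)$: $A(m,n,k)=(m,\,m+n+k,\,k+2m)$, $B(m,n,k)=(m+n+k,\,n,\,k+2n)$, $R(m,n,k)=(n,m,-k)$. A bar denotes the inverse operator: $\bar A=A^{-1}$, $\bar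 B=B^{-1}$, $\bar T=T^{-1}$. $\mathcal T^+$ is the multiplicative semigroup generated by the identity, $A$ and $B$; $\mathcal T^-$ is the one generated by the identity, $\bar A$ and $\bar B$. Subsets of $H$: $H^0=\{|S|<|D|,\ D>0\}$, $H^0_R=\{|S|<|D|,\ D<0\}$. The set $G^0=H\setminus\overline{(H^0\cup H^0_R)}$ has four connected components: $G_A=\{S>|D|,K>0\}$, $G_{\bar A}=\{S>|D|,K<0\}$, $G_B=\{S<-|D|,K<0\}$, $G_{\bar B}=\{S<-|D|,K>0\}$. Further, $H_A=\{|D|<|S|<|K|,\ S>0,\ K>0\}$, $H_{\bar A}=\{|D|<|S|<|K|,\ S>0,\ K<0\}$, $H_B=\{|D|<|S|<|K|,\ S<0,\ K<0\}$, $H_{\bar B}=\{|D|<|S|<|K|,\ S<0,\ K>0\}$. Generations of rational numbers: $0/1$ and $1/0=\infty$ have generation zero; $1/1$ has generation one; for $n\ge1$ the positive rationals of generation $n$ are the $2^{n-1}$ numbers obtained from $1/1$ by applying all words of length $n-1$ in the maps $x\mapsto x+1$ and $x\mapsto x/(x+1)$; a negative rational has the generation of its absolute value. Rhombi: for $x=p/q$ ($p,q$ coprime integers), $H^{x}$ is the image of $H^0$ under the rotation about the $S$-axis which carries the direction $(K,D)=(0,1)$ to the direction $\left(\frac{2pq}{p^2+q^2},\frac{q^2-p^2}{p^2+q^2}\right)$; explicitly $H^{p/q}=\{(K,D,S)\in H: (p^2+q^2)|S|<2pqK+(q^2-p^2)D\}$. Thus $H^{0/1}=H^0$, $H^{1/0}=H^0_R$.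 Let $H^{\mathbf n}$ be the union of all rhombi $H^x$ with $x$ of generation $n$. The domain of zero generation is $\mathcal H^{\mathbf 0}=H^0\cup H^0_R$, and for $n\ge1$ the domain of the $n$-th generation is $\mathcal H^{\mathbf n}=H^{\mathbf n}\setminus\big(H^{\mathbf n}\cap(\overline{H^{\mathbf 0}}\cup\overline{H^{\mathbf 1}}\cup\dots\cup\overline{H^{\mathbf{n-1}}})\big)$, closures taken in $H$. (In particular $\mathcal H^{\mathbf 1}=H_A\cup H_{\bar A}\cup H_B\cup H_{\bar B}$.) *)

(* Defs.v *)
From mathcomp Require Import all_boot all_order all_algebra.
From mathcomp Require Import all_classical all_reals all_analysis.
From mathcomp Require Import ring.

Set Implicit Arguments.
Unset Strict Implicit.
Unset Printing Implicit Defensive.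

Import Order.TTheory GRing.Theory Num.Theory.
Import numFieldNormedType.Exports.

Local Open Scope classical_set_scope.
Local Open Scope ring_scope.

Section Forms.
Variable R : realType.

(* The form m x^2 + n y^2 + k x y is the column vector (m, n, k). *)
Local Notation formT := 'cV[R]_3.
Local Notation operT := 'M[R]_3.

Definition cm (f : formT) : R := f 0 0.
Definition cn (f : formT) : R := f 1 0.
Definition ck (f : formT) : R := f 2 0.

Definition form_eval (f : formT) (x y : R) : R :=
  cm f * x ^+ 2 + cn f * y ^+ 2 + ck f * (x * y).

Definition cK (f : formT) : R := ck f.
Definition cD (f : formT) : R := cm f - cn f.
Definition cS (f : formT) : R := cm f + cn f.

(* Operators act on the left, so (T * U) f = T (U f). *)
Definition mx3 (s : seq (seq R)) : operT :=
  \matrix_(i, j) nth 0 (nth [::] s i) j.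

Definition opA : operT := mx3 [:: [:: 1; 0; 0]; [:: 1; 1; 1]; [:: 2; 0; 1]].
Definition opB : operT := mx3 [:: [:: 1; 1; 1]; [:: 0; 1; 0]; [:: 0; 2; 1]].

Lemma mx3E s (f : formT) (i : 'I_3) : (mx3 s *m f) i 0 =
  (nth [::] s i)`_0 * cm f + (nth [::] s i)`_1 * cn f + (nth [::] s i)`_2 * ck f.
Proof.
rewrite mxE !big_ord_recl big_ord0 !mxE addr0 addrA /cm /cn /ck.
by congr (_ * f _ 0 + _ * f _ 0 + _ * f _ 0); apply/val_inj.
Qed.

Lemma opA_coord f : [/\ cm (opA *m f) = cm f,
  cn (opA *m f) = cm f + cn f + ck f & ck (opA *m f) = ck f + 2 * cm f].
Proof. by split; apply: (etrans (mx3E _ f _)) => /=; ring. Qed.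

Lemma opB_coord f : [/\ cm (opB *m f) = cm f + cn f + ck f,
  cn (opB *m f) = cn f & ck (opB *m f) = ck f + 2 * cn f].
Proof. by split; apply: (etrans (mx3E _ f _)) => /=; ring. Qed.

Lemma form_eval_opA f x y : form_eval (opA *m f) x y = form_eval f (x + y) y.
Proof. by rewrite /form_eval; have [-> -> ->] := opA_coord f; ring. Qed.

Lemma form_eval_opB f x y : form_eval (opB *m f) x y = form_eval f x (x + y).
Proof. by rewrite /form_eval; have [-> -> ->] := opB_coord f; ring. Qed.

(* T^-1 is T itself when T is not a unit, so these two lemmas are what makes
   opA^-1 and opB^-1 the inverse operators. *)
Lemma opA_unit : opA \is a GRing.unit.
Proof.
apply: (proj1 (@mulmx1_unit _ _ _
  (mx3 [:: [:: 1; 0; 0]; [:: 1; 1; -1]; [:: -2; 0; 1]]) _)).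
by apply/matrixP => -[[|[|[|//]]] ?] -[[|[|[|//]]] ?];
  rewrite mxE !big_ord_recl big_ord0 !mxE /=; ring.
Qed.

Lemma opB_unit : opB \is a GRing.unit.
Proof.
apply: (proj1 (@mulmx1_unit _ _ _
  (mx3 [:: [:: 1; 1; -1]; [:: 0; 1; 0]; [:: 0; -2; 1]]) _)).
by apply/matrixP => -[[|[|[|//]]] ?] -[[|[|[|//]]] ?];
  rewrite mxE !big_ord_recl big_ord0 !mxE /=; ring.
Qed.

Definition semigroup_closed (M : set operT) : Prop :=
  forall T U, M T -> M U -> M (T * U).

Definition Tplus : set operT := smallest semigroup_closed [set 1; opA; opB].
Definition Tminus : set operT :=
  smallest semigroup_closed [set 1; opA^-1; opB^-1].

Definition Tplus_products (n : nat) : set operT :=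
  [set \prod_(i < n) g i | g in [set g : 'I_n -> operT |
                                 forall i, g i = opA \/ g i = opB]].

Definition act (T : operT) (X : set formT) : set formT :=
  [set T *m f | f in X].

Variable Delta : R.

Definition hyperboloid : set formT :=
  [set f | cK f ^+ 2 + cD f ^+ 2 - cS f ^+ 2 = Delta].

Definition closureH (X : set formT) : set formT :=
  hyperboloid `&` closure X.

Definition H0 : set formT :=
  hyperboloid `&` [set f | `|cS f| < `|cD f| /\ 0 < cD f].
Definition H0R : set formT :=
  hyperboloid `&` [set f | `|cS f| < `|cD f| /\ cD f < 0].

Definition G_A : set formT :=
  hyperboloid `&` [set f | `|cD f| < cS f /\ 0 < cK f].
Definition G_Abar : set formT :=
  hyperboloid `&` [set f | `|cD f| < cS f /\ cK f < 0].
Definition G_B : set formT :=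
  hyperboloid `&` [set f | cS f < - `|cD f| /\ cK f < 0].
Definition G_Bbar : set formT :=
  hyperboloid `&` [set f | cS f < - `|cD f| /\ 0 < cK f].

Definition HK : set formT :=
  hyperboloid `&` [set f | `|cD f| < `|cS f| < `|cK f|].
Definition H_A : set formT := HK `&` [set f | 0 < cS f /\ 0 < cK f].
Definition H_Abar : set formT := HK `&` [set f | 0 < cS f /\ cK f < 0].
Definition H_B : set formT := HK `&` [set f | cS f < 0 /\ cK f < 0].
Definition H_Bbar : set formT := HK `&` [set f | cS f < 0 /\ 0 < cK f].

Definition rhombus (p q : R) : set formT :=
  hyperboloid `&` [set f | (p ^+ 2 + q ^+ 2) * `|cS f|
                           < 2 * p * q * cK f + (q ^+ 2 - p ^+ 2) * cD f].

(* None stands for 1/0. *)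
Definition rhombus_at (x : option rat) : set formT :=
  if x is Some r then rhombus (numq r)%:~R (denq r)%:~R else rhombus 1 0.

Lemma rhombus_at0 : rhombus_at (Some 0) = H0.
Proof.
rewrite /rhombus_at (_ : numq 0 = 0) // (_ : denq 0 = 1) // mulr0z mulr1z.
rewrite /rhombus /H0; congr (_ `&` _); apply/seteqP; split=> f; rewrite /mkset.
- rewrite (_ : _ * _ = `|cS f|); last by ring.
  rewrite (_ : _ + _ = cD f); last by ring.
  by move=> h; have D0 := le_lt_trans (normr_ge0 _) h; rewrite (gtr0_norm D0).
- case=> h D0; rewrite (gtr0_norm D0) in h.
  rewrite (_ : _ * _ = `|cS f|); last by ring.
  by rewrite (_ : _ + _ = cD f); last by ring.
Qed.

Lemma rhombus_at_infty : rhombus_at None = H0R.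
Proof.
rewrite /rhombus_at /rhombus /H0R; congr (_ `&` _).
apply/seteqP; split=> f; rewrite /mkset.
- rewrite (_ : _ * _ = `|cS f|); last by ring.
  rewrite (_ : _ + _ = - cD f); last by ring.
  move=> h; have := le_lt_trans (normr_ge0 _) h; rewrite oppr_gt0 => D0.
  by rewrite (ltr0_norm D0).
- case=> h D0; rewrite (ltr0_norm D0) in h.
  rewrite (_ : _ * _ = `|cS f|); last by ring.
  by rewrite (_ : _ + _ = - cD f); last by ring.
Qed.

(* The positive rationals of generation n.+1. *)
Fixpoint pos_generation (n : nat) : set rat :=
  if n is n'.+1 then
    [set x + 1 | x in pos_generation n'] `|`
    [set x / (x + 1) | x in pos_generation n']
  else [set 1].

Definition generation (n : nat) : set (option rat) :=
  if n is n'.+1 then [set Some x | x in [set x | pos_generation n' `|x|]]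
  else [set Some 0; None].

Definition Hgen (n : nat) : set formT :=
  \bigcup_(x in generation n) rhombus_at x.

Definition gen_domain (n : nat) : set formT :=
  if n is 0 then H0 `|` H0R
  else Hgen n `\` (Hgen n `&` \bigcup_(j in `I_n) closureH (Hgen j)).

Definition components (X : set formT) : set (set formT) :=
  [set connected_component X f | f in X].

Definition domain_components (n : nat) (G : set formT) : set (set formT) :=
  components (gen_domain n) `&` [set C | C `<=` G].

Definition all_domain_components (G : set formT) : set (set formT) :=
  \bigcup_(n in [set n | (0 < n)%N]) domain_components n G.

End Forms.

(* Main.v *)
Require Import Defs.
From mathcomp Require Import all_boot all_order all_algebra.
From mathcomp Require Import all_classical all_reals all_analysis.
From mathcomp Require Import ring lra.

Import Order.TTheory GRing.Theory Num.Theory.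
Import numFieldNormedType.Exports.

Local Open Scope classical_set_scope.
Local Open Scope ring_scope.

Set Implicit Arguments.
Unset Strict Implicit.
Unset Printing Implicit Defensive.

(** A form f in G_A has positive coefficients m, n, k and positive discriminant,
so f(x, -1) vanishes at exactly two real numbers x, both positive.  Call the
interval between them the interval of f.  The rhombus of a rational r > 0 meets
G_A in the forms whose interval contains r in its interior, since there the other
inequality f(1, r) > 0 is automatic; the rhombus of a rational r < 0 misses G_A.
So f lies in the domain of generation n+1 if and only if its open interval
contains a rational of that generation and its closed interval contains no
positive rational of an earlier one ([gen_domain_G_AE]).

The operator A moves the interval by x |-> x + 1 and B moves it by
x |-> x / (x + 1).  These are the two maps that produce each generation from the
previous one, and they send the positive half-line onto the two sides of 1.  Hence
A and B carry the part in G_A of the domain of generation n+1 into that of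
generation n+2 ([gen_domain_opA], [gen_domain_opB]).  In the other direction, the
interval of a form of generation n+2 avoids 1, so n - m does not vanish there, and
its sign tells whether the form comes from A or from B.  A connected set cannot
change this sign, so by induction a connected subset of the domain of generation
n+1 in G_A lies in T H_A for a single word T of length n in A and B
([connected_in_word]).  The set H_A is connected ([H_A_connected]), and images of
it under different words are disjoint ([word_inj]), so the sets T H_A are
precisely the components ([component_word], [domain_components_G_A]).  Disjointness
also makes T |-> T H_A injective on the whole semigroup.  Components found in the
full domain do not leave G_A because the domain avoids the walls mn = 0, which lie
in the closure of generation zero ([gen_domain_definite]).

The three other quadrants follow by symmetry.  The involutions f |-> f(x, -y) and
f |-> -f send the rhombus of r to those of -r and -1/r, and so preserve every
generation ([symmetryJ], [symmetryN]).  The first one conjugates A and B into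
their inverses, which turns words of T+ into words of T-; the second commutes with
every operator. *)

(** * Coordinates, rhombi and quadrants *)

Section Coordinates.
Variable R : realType.
Implicit Types (f g : 'cV[R]_3) (T U : 'M[R]_3) (x y p q m n k : R).

Definition mkform m n k : 'cV[R]_3 := \col_i [:: m; n; k]`_i.

Lemma mkform_coord m n k : [/\ cm (mkform m n k) = m,
  cn (mkform m n k) = n & ck (mkform m n k) = k].
Proof. by split; rewrite /cm /cn /ck mxE. Qed.

Lemma form_ext f g : cm f = cm g -> cn f = cn g -> ck f = ck g -> f = g.
Proof.
rewrite /cm /cn /ck => em en ek; apply/colP => -[[|[|[|//]]] i].
- by rewrite (_ : Ordinal i = 0) //; apply/val_inj.
- by rewrite (_ : Ordinal i = 1) //; apply/val_inj.
- by rewrite (_ : Ordinal i = 2) //; apply/val_inj.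
Qed.

Lemma opp_coord f : [/\ cm (- f) = - cm f, cn (- f) = - cn f & ck (- f) = - ck f].
Proof. by split; rewrite /cm /cn /ck mxE. Qed.

(** The substitution f(x, -y). *)
Definition opJ : 'M[R]_3 := mx3 [:: [:: 1; 0; 0]; [:: 0; 1; 0]; [:: 0; 0; -1]].

Lemma opJ_coord f : [/\ cm (opJ *m f) = cm f, cn (opJ *m f) = cn f
  & ck (opJ *m f) = - ck f].
Proof. by split; apply: (etrans (mx3E _ f _)) => /=; ring. Qed.

Lemma mulop_act T U f : (T * U) *m f = T *m (U *m f).
Proof. by rewrite mulmxA. Qed.

Lemma op_ext T U : (forall f, T *m f = U *m f) -> T = U.
Proof.
move=> TU; apply/matrixP => i j.
by have /colP/(_ i) := TU (delta_mx j 0); rewrite -!colE !mxE.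
Qed.

Lemma opJK : opJ * opJ = 1.
Proof.
apply: op_ext => f; rewrite mulop_act mul1mx.
have [m1 n1 k1] := opJ_coord (opJ *m f); have [m2 n2 k2] := opJ_coord f.
by apply: form_ext; rewrite ?m1 ?m2 ?n1 ?n2 ?k1 ?k2 ?opprK.
Qed.

Lemma opJ_conjA : opJ * (@opA R) * opJ = (@opA R)^-1.
Proof.
apply: (mulrI (opA_unit R)); rewrite mulrV ?opA_unit //.
apply: op_ext => f; rewrite !mulop_act mul1mx.
have [m1 n1 k1] := opJ_coord f; set g := opJ *m f in m1 n1 k1 *.
have [m2 n2 k2] := opA_coord g; set h := opA R *m g in m2 n2 k2 *.
have [m3 n3 k3] := opJ_coord h; set l := opJ *m h in m3 n3 k3 *.
have [m4 n4 k4] := opA_coord l.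
by apply: form_ext; rewrite ?m4 ?n4 ?k4 m3 ?n3 ?k3 m2 ?n2 ?k2 m1 ?n1 ?k1; ring.
Qed.

Lemma opJ_conjB : opJ * (@opB R) * opJ = (@opB R)^-1.
Proof.
apply: (mulrI (opB_unit R)); rewrite mulrV ?opB_unit //.
apply: op_ext => f; rewrite !mulop_act mul1mx.
have [m1 n1 k1] := opJ_coord f; set g := opJ *m f in m1 n1 k1 *.
have [m2 n2 k2] := opB_coord g; set h := opB R *m g in m2 n2 k2 *.
have [m3 n3 k3] := opJ_coord h; set l := opJ *m h in m3 n3 k3 *.
have [m4 n4 k4] := opB_coord l.
by apply: form_ext; rewrite ?m4 ?n4 ?k4 ?m3 n3 ?k3 ?m2 n2 ?k2 ?m1 n1 ?k1; ring.
Qed.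

Variable Delta : R.

Lemma hyperboloidE f :
  hyperboloid Delta f <-> ck f ^+ 2 - 4 * cm f * cn f = Delta.
Proof.
rewrite /hyperboloid /= /cK /cD /cS.
by split=> <-; ring.
Qed.

(** The rhombus condition |(p^2 + q^2) S| < 2pqK + (q^2 - p^2) D is a pair of
linear inequalities in f, and each of them is the sign of one value of f: with S
in place of |S|, half the difference of the two sides is -f(p, -q) and half
their sum is f(q, p). This is what lets substitutions act on rhombi. *)
Lemma rhombusE p q f : rhombus Delta p q f <->
  [/\ hyperboloid Delta f, 0 < form_eval f q p & form_eval f p (- q) < 0].
Proof.
rewrite /rhombus /=.
have [pq0|pq0] := eqVneq (p ^+ 2 + q ^+ 2) 0.
  have p0 : p = 0 by nra.
  have q0 : q = 0 by nra.
  rewrite p0 q0 /form_eval; split; first by case=> _ /=; lra.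
  by case=> _; lra.
have pq_gt0 : 0 < p ^+ 2 + q ^+ 2 by nra.
have E : ((p ^+ 2 + q ^+ 2) * `|cS f| < 2 * p * q * cK f + (q ^+ 2 - p ^+ 2) * cD f)
   <-> 0 < form_eval f q p /\ form_eval f p (- q) < 0.
  rewrite -[X in X * `|_|](gtr0_norm pq_gt0) -normrM ltr_norml.
  rewrite /form_eval /cS /cK /cD.
  by split=> [/andP[h1 h2]|[h1 h2]]; [split|apply/andP; split]; nra.
by split=> [[? /E[]]|[? ? ?]]; split=> //; apply/E.
Qed.

Lemma rhombus_ratE (r : rat) f : rhombus_at Delta (Some r) f <->
  [/\ hyperboloid Delta f, 0 < form_eval f 1 (ratr r)
    & form_eval f (ratr r) (-1) < 0].
Proof.
rewrite /rhombus_at rhombusE.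
have q0 : 0 < (denq r)%:~R :> R by rewrite ltr0z denq_gt0.
have -> : (numq r)%:~R = ratr r * (denq r)%:~R :> R.
  by rewrite /ratr mulfVK // gt_eqF.
set q : R := _%:~R in q0 *.
have q2 : 0 < q ^+ 2 by rewrite exprn_gt0.
have -> : form_eval f q (ratr r * q) = q ^+ 2 * form_eval f 1 (ratr r).
  by rewrite /form_eval; ring.
have -> : form_eval f (ratr r * q) (- q) = q ^+ 2 * form_eval f (ratr r) (-1).
  by rewrite /form_eval; ring.
by rewrite pmulr_rgt0 // pmulr_rlt0.
Qed.

Lemma H0E f : H0 Delta f <-> [/\ hyperboloid Delta f, 0 < cm f & cn f < 0].
Proof.
rewrite -rhombus_at0 rhombus_ratE rmorph0 /form_eval.
by split=> -[h a b]; split=> //; move: a b; lra.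
Qed.

Lemma H0RE f : H0R Delta f <-> [/\ hyperboloid Delta f, cm f < 0 & 0 < cn f].
Proof.
rewrite -rhombus_at_infty /rhombus_at rhombusE /form_eval.
by split=> -[h a b]; split=> //; move: a b; lra.
Qed.

Lemma G_AE f : G_A Delta f <->
  [/\ hyperboloid Delta f, 0 < cm f, 0 < cn f & 0 < ck f].
Proof.
rewrite /G_A /= /cD /cS /cK ltr_norml.
by split=> [[h [/andP[? ?] ?]]|[h ? ? ?]]; split=> //; lra.
Qed.

Lemma H_AE f : H_A Delta f <->
  [/\ hyperboloid Delta f, 0 < cm f, 0 < cn f & cm f + cn f < ck f].
Proof.
rewrite /H_A /HK /= /cD /cS /cK; split.
  move=> [[h /andP[h1 h2]] [S0 K0]].
  move: h1 h2; rewrite (gtr0_norm S0) (gtr0_norm K0) ltr_norml => /andP[? ?] ?.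
  by split=> //; lra.
move=> [h ? ? ?]; have S0 : 0 < cm f + cn f by lra.
have K0 : 0 < ck f by lra.
do !split=> //; rewrite (gtr0_norm S0) (gtr0_norm K0) ltr_norml.
by do !(apply/andP; split); lra.
Qed.

End Coordinates.

(** * Continuity, closures and connected sets *)

Section Topology.
Variable R : realType.
Implicit Types (f g : 'cV[R]_3) (T : 'M[R]_3) (X C : set 'cV[R]_3).

Lemma cm_continuous : continuous (@cm R). Proof. exact: coord_continuous. Qed.
Lemma cn_continuous : continuous (@cn R). Proof. exact: coord_continuous. Qed.
Lemma ck_continuous : continuous (@ck R). Proof. exact: coord_continuous. Qed.

Lemma lincomb_continuous (V : topologicalType) (u v w : V -> R) (a b c : R) :
  continuous u -> continuous v -> continuous w ->
  continuous (fun t => a * u t + b * v t + c * w t).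
Proof.
move=> cu cv cw t; apply: cvgD; [apply: cvgD|]; apply: cvgMl_tmp.
- exact: cu.
- exact: cv.
- exact: cw.
Qed.

Lemma linear_form_continuous (a b c : R) :
  continuous (fun f : 'cV[R]_3 => a * cm f + b * cn f + c * ck f).
Proof.
by apply: lincomb_continuous;
  [exact: cm_continuous|exact: cn_continuous|exact: ck_continuous].
Qed.

Lemma form_eval_continuous (x y : R) : continuous (fun f => form_eval f x y).
Proof.
rewrite (_ : (fun f => _) = fun f => x ^+ 2 * cm f + y ^+ 2 * cn f + (x * y) * ck f).
  exact: linear_form_continuous.
by apply/funext => f; rewrite /form_eval; ring.
Qed.

Lemma mkform_continuous (V : topologicalType) (a b c : V -> R) :
  continuous a -> continuous b -> continuous c ->
  continuous (fun t => mkform (a t) (b t) (c t)).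
Proof.
move=> ca cb cc.
rewrite (_ : (fun _ => _) = fun s => a s *: mkform 1 0 0 + b s *: mkform 0 1 0
    + c s *: mkform 0 0 1).
  move=> t; apply: cvgD; [apply: cvgD|]; apply: cvgZr_tmp.
  - exact: ca.
  - exact: cb.
  - exact: cc.
apply/funext => s; apply/colP => -[[|[|[|//]]] i]; rewrite !mxE /=; ring.
Qed.

Lemma mulmx_continuous T : continuous (mulmx T : 'cV[R]_3 -> 'cV[R]_3).
Proof.
rewrite (_ : mulmx T = fun f => mkform
   (T 0 0 * cm f + T 0 1 * cn f + T 0 2 * ck f)
   (T 1 0 * cm f + T 1 1 * cn f + T 1 2 * ck f)
   (T 2 0 * cm f + T 2 1 * cn f + T 2 2 * ck f)).
  by apply: mkform_continuous; exact: linear_form_continuous.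
apply/funext => f.
have E i : (T *m f) i 0 = T i 0 * cm f + T i 1 * cn f + T i 2 * ck f.
  rewrite mxE !big_ord_recl big_ord0 addr0 addrA /cm /cn /ck.
  by congr (T _ _ * f _ 0 + T _ _ * f _ 0 + T _ _ * f _ 0); apply/val_inj.
by apply: form_ext; rewrite /cm /cn /ck E mxE.
Qed.

Lemma act1 X : act 1 X = X.
Proof.
apply/seteqP; split=> [_ [f Xf <-]|f Xf]; first by rewrite mul1mx.
by exists f; rewrite ?mul1mx.
Qed.

Lemma actM T U X : act (T * U) X = act T (act U X).
Proof.
apply/seteqP; split=> [_ [f Xf <-]|_ [_ [f Xf <-] <-]].
  by exists (U *m f); [exists f|rewrite mulop_act].
by exists f; rewrite ?mulop_act.
Qed.

Lemma act_connected T C : connected C -> connected (act T C).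
Proof.
move=> Cc; apply: connected_continuous_connected => //.
by apply: continuous_subspaceT; exact: mulmx_continuous.
Qed.

(** The way components are separated below: a continuous function that does not
vanish on a connected set has a constant sign there. *)
Lemma connected_sign C (g : 'cV[R]_3 -> R) : continuous g -> connected C ->
  (forall f, C f -> g f != 0) ->
  (forall f, C f -> 0 < g f) \/ (forall f, C f -> g f < 0).
Proof.
move=> gc Cc g0.
have /connected_intervalP gCi : connected (g @` C).
  apply: connected_continuous_connected => //; exact: continuous_subspaceT.
have [[f Cf f_lt0]|noneg] := pselect (exists2 f, C f & g f < 0); last first.
  left=> f Cf; rewrite lt_def g0 //= leNgt; apply/negP => fn.
  by apply: noneg; exists f.
right=> h Ch; rewrite lt_def eq_sym g0 //= leNgt; apply/negP => h_gt0.
have [l Cl l0] := gCi (g f) (g h) (ex_intro2 _ _ f Cf erefl)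
  (ex_intro2 _ _ h Ch erefl) 0 (introT andP (conj (ltW f_lt0) (ltW h_gt0))).
by have := g0 l Cl; rewrite l0 eqxx.
Qed.

Lemma closure_curve X (c : R -> 'cV[R]_3) (d : R) : 0 < d -> continuous c ->
  (forall e, 0 < e < d -> X (c e)) -> closure X (c 0).
Proof.
move=> d0 cc Xc U Uc0.
have Uc : \forall e \near (0 : R)^'+, U (c e).
  by apply: (cvg_at_right_filter (cc 0)).
have Xd : \forall e \near (0 : R)^'+, X (c e).
  near=> e; apply: Xc; apply/andP; split; near: e.
    exact: nbhs_right_gt.
  exact: nbhs_right_lt.
by have [e [Xe Ue]] := @filter_ex _ _ (at_right_proper_filter 0) _ (filterI Xd Uc);
  exists (c e).
Unshelve. all: by end_near. Qed.

Lemma act_closure T X f : closure X f -> closure (act T X) (T *m f).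
Proof.
move=> Xf U /mulmx_continuous/Xf [g [Xg Ug]].
by exists (T *m g); split=> //; exists g.
Qed.

(** An involution that preserves X permutes its components; only the inclusion
of the image of a component in a component needs a topological argument, the
other one follows by applying the involution again. *)
Lemma act_connected_component T X f :
  T * T = 1 -> act T X = X ->
  connected_component X (T *m f) = act T (connected_component X f).
Proof.
move=> TT TX.
have sub g : act T (connected_component X g) `<=` connected_component X (T *m g).
  have [Xg|nXg] := pselect (X g); last first.
    by rewrite connected_component_out // => ? [].
  apply: connected_component_max.
  - exists g; first exact: connected_component_refl.
    by [].
  - move=> _ [h hg <-]; rewrite -TX; exists h => //.
    exact: connected_component_sub hg.
  - by apply: act_connected; exact: component_connected.
apply/seteqP; split; last exact: sub.
rewrite -[X in X `<=` _]act1 -TT actM => _ [g /sub + <-].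
by rewrite -mulop_act TT mul1mx; exists g.
Qed.

End Topology.

(** * Closures of rhombi and the domains of each generation *)

Section PosGenerations.
Implicit Types (x : rat) (n : nat).

Lemma pos_generation_gt0 n x : pos_generation n x -> 0 < x.
Proof.
elim: n x => [|n IH] x /=; first by move->.
by case=> -[y /IH y0 <-]; [exact: addr_gt0|apply: divr_gt0 => //; exact: addr_gt0].
Qed.

(** Inversion exchanges x + 1 and x / (x + 1). It is needed for the symmetry f
|-> -f, which sends the rhombus of r to that of -1/r. *)
Lemma pos_generationV n x : pos_generation n x -> pos_generation n x^-1.
Proof.
elim: n x => [|n IH] x /=; first by move->; rewrite invr1.
case=> -[y ny <-]; have y0 := pos_generation_gt0 ny.
  right; exists y^-1; first exact: IH.
  by field; rewrite !gt_eqF ?addr_gt0 ?invr_gt0.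
left; exists y^-1; first exact: IH.
by field; rewrite !gt_eqF ?addr_gt0 ?invr_gt0.
Qed.

Lemma finite_pos_generation n : finite_set (pos_generation n).
Proof.
elim: n => [|n IH] /=; first exact: finite_set1.
by rewrite finite_setU; split; exact: finite_image.
Qed.

Lemma finite_generation n : finite_set (generation n).
Proof.
case: n => [|n] /=; first by rewrite finite_setU; split; exact: finite_set1.
apply: finite_image.
apply: (@sub_finite_set _ _ (pos_generation n `|` -%R @` pos_generation n)).
  move=> x /=; case: (ltP x 0) => x0 nx; [right|left].
    by exists `|x| => //; rewrite ltr0_norm // opprK.
  by rewrite ger0_norm in nx.
rewrite finite_setU; split; first exact: finite_pos_generation.
by apply: finite_image; exact: finite_pos_generation.
Qed.

End PosGenerations.

Section GenerationDomains.
Variables (R : realType) (Delta : R).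
Hypothesis Delta_gt0 : 0 < Delta.
Implicit Types (f g : 'cV[R]_3) (r : rat) (n i : nat).

Lemma Hgen0E f : Hgen Delta 0 f <-> hyperboloid Delta f /\ cm f * cn f < 0.
Proof.
split=> [[_ [->|->]]|[hf]].
- by rewrite rhombus_at0 => /H0E[? ? ?]; split=> //; nra.
- by rewrite rhombus_at_infty => /H0RE[? ? ?]; split=> //; nra.
move=> mn; have [m0|m0|m0] := ltgtP (cm f) 0.
- by exists None; [right|rewrite rhombus_at_infty; apply/H0RE; split=> //; nra].
- by exists (Some 0); [left|rewrite rhombus_at0; apply/H0E; split=> //; nra].
- by rewrite m0 mul0r ltxx in mn.
Qed.

(** The square (a x + b y)^2. Adding a multiple of it to a form that has the
linear factor a x + b y changes the other factor only and keeps the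
discriminant: these are the straight lines of the hyperboloid, and they provide
all the small deformations used to compute closures. *)
Definition square_form (a b : R) : 'cV[R]_3 := mkform (a ^+ 2) (b ^+ 2) (2 * (a * b)).

Lemma addsquare_coord f (t a b : R) : [/\
  cm (f + t *: square_form a b) = cm f + t * a ^+ 2,
  cn (f + t *: square_form a b) = cn f + t * b ^+ 2
  & ck (f + t *: square_form a b) = ck f + 2 * t * (a * b)].
Proof. by split; rewrite /cm /cn /ck !mxE /= ?[2 * t]mulrC ?mulrA. Qed.

Lemma hyperboloid_ruling f (t a b : R) : hyperboloid Delta f ->
  form_eval f b (- a) = 0 -> hyperboloid Delta (f + t *: square_form a b).
Proof.
move=> /hyperboloidE kf fab; apply/hyperboloidE.
have [-> -> ->] := addsquare_coord f t a b.
rewrite (_ : _ - _ = ck f ^+ 2 - 4 * cm f * cn f - 4 * t * form_eval f b (- a)).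
  by rewrite kf fab mulr0 subr0.
by rewrite /form_eval; ring.
Qed.

Lemma closure_ruling (X : set 'cV[R]_3) f (a b s d : R) : 0 < d ->
  (forall e, 0 < e < d -> X (f + (e * s) *: square_form a b)) -> closure X f.
Proof.
move=> d0 Xf; pose c e := f + (e * s) *: square_form a b.
rewrite (_ : f = c 0); last by rewrite /c mul0r scale0r addr0.
apply: closure_curve d0 _ Xf => e.
apply: cvgD; first exact: cvg_cst.
by apply: cvgZr_tmp; apply: cvgMr_tmp; exact: cvg_id.
Qed.

(** Generation zero consists of the forms with mn < 0, so the claim is about the
walls. If m = 0 and n <> 0 the form is y (k x + n y); moving along the line that
keeps the factor k x + n y makes mn negative. The vertices m = n = 0 are limits
of such points. *)
Lemma closure_Hgen0 f : hyperboloid Delta f -> cm f * cn f <= 0 ->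
  closure (Hgen Delta 0) f.
Proof.
have dn g : hyperboloid Delta g -> cm g = 0 -> cn g != 0 -> closure (Hgen Delta 0) g.
  move=> /[dup] hg /hyperboloidE kg m0 n0.
  apply: (@closure_ruling _ _ (ck g) (cn g) (- (cn g)^-1) 1) => // e /andP[e0 e1].
  apply/Hgen0E; split.
    by apply: hyperboloid_ruling => //; rewrite /form_eval m0; ring.
  have [-> -> _] := addsquare_coord g (e * - (cn g)^-1) (ck g) (cn g).
  have k2 : ck g ^+ 2 = Delta by rewrite -kg m0; ring.
  (* Along this line mn = - Delta e (1 - e). *)
  rewrite k2 m0 (_ : _ * _ = - (Delta * (e * (1 - e)))); last by field.
  by rewrite oppr_lt0 !mulr_gt0 // subr_gt0.
move=> /[dup] hf /hyperboloidE kf.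
rewrite le_eqVlt => /predU1P[/eqP|mn]; last first.
  by apply: subset_closure; apply/Hgen0E.
rewrite mulf_eq0; have [n0|n0] := eqVneq (cn f) 0; last first.
  by rewrite orbF => /eqP m0; exact: dn.
move=> _; have k2 : ck f ^+ 2 = Delta by rewrite -kf n0; ring.
have [m0|m0] := eqVneq (cm f) 0.
  rewrite (iffLR (closure_id _) (@closed_closure _ (Hgen Delta 0))).
  apply: (@closure_ruling _ _ 0 1 1 1) => // e /andP[e0 e1].
  have [m1 n1 _] := addsquare_coord f (e * 1) 0 1.
  apply: dn; first by apply: hyperboloid_ruling => //; rewrite /form_eval m0; ring.
    by rewrite m1 m0; ring.
  by rewrite n1 n0 expr1n !mulr1 add0r gt_eqF.
apply: (@closure_ruling _ _ (cm f) (ck f) (- (cm f)^-1) 1) => // e /andP[e0 e1].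
apply/Hgen0E; split.
  by apply: hyperboloid_ruling => //; rewrite /form_eval n0; ring.
have [-> -> _] := addsquare_coord f (e * - (cm f)^-1) (cm f) (ck f).
rewrite k2 n0 (_ : _ * _ = - (Delta * (e * (1 - e)))); last by field.
by rewrite oppr_lt0 !mulr_gt0 // subr_gt0.
Qed.

Lemma gen_domain_hyperboloid n f : gen_domain Delta n f -> hyperboloid Delta f.
Proof.
case: n => [|n] /=; first by case=> -[].
by case=> -[[r|] _] + _; case.
Qed.

(** The domains of positive generation are disjoint from the closure of
generation zero, hence lie where m and n have the same strict sign. *)
Lemma gen_domain_definite n f : gen_domain Delta n.+1 f -> 0 < cm f * cn f.
Proof.
move=> fn; have hf := gen_domain_hyperboloid fn.
case: fn => fn nfn; rewrite ltNge; apply/negP => mn; apply: nfn; split=> //.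
by exists 0%N => //; split=> //; exact: closure_Hgen0.
Qed.

(** If f(r, -1) = 0 then f has the linear factors x + r y and m x + (n / r) y.
Subtracting a small multiple of the square of the second factor makes the value
at (r, -1) negative, because that factor is nonzero there: its square at this
point is the discriminant. *)
Lemma closure_rhombus_root r f : G_A Delta f -> 0 < r ->
  form_eval f (ratr r) (-1) <= 0 -> closure (rhombus_at Delta (Some r)) f.
Proof.
move=> Gf r0; have r0' : 0 < ratr r :> R by rewrite ltr0q.
have /G_AE[/[dup] hf /hyperboloidE kf m0 n0 k0] := Gf.
have pos g : 0 < cm g -> 0 < cn g -> 0 < ck g -> 0 < form_eval g 1 (ratr r).
  by rewrite /form_eval; nra.
rewrite le_eqVlt => /predU1P[rf|rf]; last first.
  by apply: subset_closure; apply/rhombus_ratE; split=> //; exact: pos.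
set x : R := ratr r in r0' rf *.
have xr : x != 0 by rewrite gt_eqF.
pose a := cm f; pose b := cn f / x.
have fab : form_eval f b (- a) = 0.
  rewrite (_ : form_eval f b _ = (cm f * cn f / x ^+ 2) * form_eval f x (-1)).
    by rewrite rf mulr0.
  by rewrite /form_eval /a /b; field.
(* The value at (1, r) must stay positive, which bounds the parameter. *)
have ab0 : 0 < (a + b * x) ^+ 2.
  by rewrite exprn_gt0 // addr_gt0 // mulr_gt0 // divr_gt0.
have f1 := pos f m0 n0 k0; rewrite -/x in f1.
apply: (@closure_ruling _ _ a b (-1) (form_eval f 1 x / (a + b * x) ^+ 2)).
  exact: divr_gt0.
move=> e /andP[e0 ed]; apply/rhombus_ratE; rewrite -/x.
have [m1 n1 k1] := addsquare_coord f (e * -1) a b.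
have abD : (a * x - b) ^+ 2 = Delta.
  rewrite -kf.
  rewrite (_ : _ ^+ 2 = (a * x + b) ^+ 2 - 4 * cm f * cn f); last first.
    by rewrite /a /b; field.
  have -> // : a * x + b = ck f.
  apply: (mulIf xr); move: rf; rewrite /form_eval /a /b => rf.
  rewrite mulrDl divfK //; apply/eqP; rewrite -subr_eq0; apply/eqP; rewrite -rf; ring.
split; first exact: hyperboloid_ruling.
- rewrite ltr_pdivlMr // in ed.
  rewrite (_ : form_eval _ _ _ = form_eval f 1 x - e * (a + b * x) ^+ 2) ?subr_gt0 //.
  by rewrite /form_eval m1 n1 k1; ring.
rewrite (_ : form_eval _ _ _ = form_eval f x (-1) - e * (a * x - b) ^+ 2).
  by rewrite rf abD sub0r oppr_lt0 mulr_gt0.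
by rewrite /form_eval m1 n1 k1; ring.
Qed.

(** A vector at which f is nonpositive on the closed rhombus of x. This one
inequality suffices to bound the closure from above inside G_A. *)
Definition slope_vector (x : option rat) : R * R :=
  if x is Some r then (ratr r, -1) else (1, 0).

(** The finiteness of a generation matters here: a finite union of closed
half-spaces is closed, so it contains the closure of the union of the rhombi. *)
Lemma closure_Hgen j f : closure (Hgen Delta j) f -> exists2 x, generation j x &
  form_eval f (slope_vector x).1 (slope_vector x).2 <= 0.
Proof.
pose Q x : set 'cV[R]_3 :=
  [set g | form_eval g (slope_vector x).1 (slope_vector x).2 <= 0].
have Qc : closed (\bigcup_(x in generation j) Q x).
  apply: closed_bigcup; first exact: finite_generation.
  move=> x _; apply: (@preimage_closed _ _ (fun g => form_eval g _ _) _ _ (@closed_le _ 0)).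
  by move=> g _; exact: form_eval_continuous.
have sub : Hgen Delta j `<=` \bigcup_(x in generation j) Q x.
  move=> g [x jx gx]; exists x => //.
  case: x jx gx => [r|] _; first by move=> /rhombus_ratE[_ _ /ltW].
  by rewrite rhombus_at_infty => /H0RE[_ m0 _]; rewrite /Q /form_eval /=; lra.
by move=> /(closureS sub)/Qc.
Qed.

Lemma form_eval_le0_G_A x f : G_A Delta f ->
  form_eval f (slope_vector x).1 (slope_vector x).2 <= 0 ->
  exists2 r, x = Some r & 0 < r.
Proof.
move=> /G_AE[_ m0 n0 k0]; rewrite /form_eval; case: x => [r|] /= rf; last by nra.
exists r => //; rewrite ltNge; apply/negP => r0.
by have : ratr r <= 0 :> R; [rewrite lerq0|nra].
Qed.

Lemma closure_Hgen_root i f : G_A Delta f -> closure (Hgen Delta i.+1) f ->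
  exists2 r, pos_generation i r & form_eval f (ratr r) (-1) <= 0.
Proof.
move=> Gf /closure_Hgen[x xi xf]; have [r xr r0] := form_eval_le0_G_A Gf xf.
rewrite xr in xi xf; exists r => //.
by case: xi => q /= iq [qr]; rewrite -qr gtr0_norm ?qr // in iq *.
Qed.

Lemma Hgen0_closure f : G_A Delta f -> ~ closure (Hgen Delta 0) f.
Proof.
move=> Gf /closure_Hgen[x x0 xf]; have [r xr r0] := form_eval_le0_G_A Gf xf.
by move: x0; rewrite xr => -[[r00]|//]; rewrite r00 ltxx in r0.
Qed.

(** In terms of the interval of f: the open interval contains a rational of
generation n+1, and the closed interval contains no positive rational of an
earlier generation. The index is shifted: [pos_generation n] is the set of
positive rationals of generation n+1. *)
Lemma gen_domain_G_AE n f : G_A Delta f -> gen_domain Delta n.+1 f <->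
  (exists2 r, pos_generation n r & form_eval f (ratr r) (-1) < 0) /\
  (forall i r, (i < n)%N -> pos_generation i r -> 0 < form_eval f (ratr r) (-1)).
Proof.
move=> Gf; have /G_AE[hf m0 n0 k0] := Gf.
have HE : Hgen Delta n.+1 f <->
    exists2 r, pos_generation n r & form_eval f (ratr r) (-1) < 0.
  split=> [[_ [r /= nr <-]] /rhombus_ratE[_ _ rf]|[r nr rf]].
    exists r => //; rewrite gtr0_norm // in nr.
    have : ~~ (r <= 0).
      apply/negP => r0; have : ratr r <= 0 :> R by rewrite lerq0.
      by move: rf; rewrite /form_eval; nra.
    by rewrite -ltNge.
  have r0 : 0 < ratr r :> R by rewrite ltr0q (pos_generation_gt0 nr).
  exists (Some r).
    by exists r => //=; rewrite gtr0_norm // (pos_generation_gt0 nr).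
  by apply/rhombus_ratE; split=> //; rewrite /form_eval; nra.
split=> [[/HE fn nfn]|[fn pos]].
  split=> // i r lt_in ir; rewrite ltNge; apply/negP => rf; apply: nfn.
  split; first exact/HE; exists i.+1 => //; split=> //.
  have r0 := pos_generation_gt0 ir.
  apply: closureS (closure_rhombus_root Gf r0 rf) => g rg.
  by exists (Some r) => //; exists r => //=; rewrite gtr0_norm.
split; first exact/HE; case=> _ [[|i] /= lt_in [_]].
  exact: Hgen0_closure.
move=> /(closure_Hgen_root Gf)[r ir]; rewrite leNgt => /negP; apply.
exact: pos ir.
Qed.

End GenerationDomains.

(** * Semigroup words and the components in G_A *)

Section Words.
Variable R : realType.

(** Products indexed by boolean words: equality of operators is compared through
equality of words. *)
Definition word (a b : 'M[R]_3) (s : seq bool) : 'M[R]_3 :=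
  \prod_(c <- s) (if c then a else b).

Lemma word_cons a b c s : word a b (c :: s) = (if c then a else b) * word a b s.
Proof. exact: big_cons. Qed.

Lemma smallest_semigroup_word (a b : 'M[R]_3) :
  smallest (@semigroup_closed R) [set 1; a; b] = range (word a b).
Proof.
apply/seteqP; split.
  apply: smallest_sub; first by
    move=> _ _ [s _ <-] [t _ <-]; exists (s ++ t) => //; rewrite /word big_cat.
  by move=> _ [[->|->]|->]; [exists [::]|exists [:: true]|exists [:: false]];
    rewrite // /word ?big_nil // big_cons big_nil mulr1.
move=> _ [s _ <-] M [Mc Ms]; elim: s => [|c s IH].
  by rewrite /word big_nil; apply: Ms; left; left.
rewrite word_cons; apply: Mc => //; apply: Ms.
by case: c; [left; right|right].
Qed.

Lemma Tplus_products_word n :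
  Tplus_products n = word (@opA R) (@opB R) @` [set s | size s = n].
Proof.
apply/seteqP; split=> [_ [g gP <-]|_ [s <- <-]].
  elim: n g gP => [|n IH] g gP; first by exists [::]; rewrite // /word big_nil big_ord0.
  have [s sn sg] := IH (fun i => g (lift ord0 i)) (fun i => gP _).
  rewrite big_ord_recl -sg; case: (gP ord0) => ->.
    by exists (true :: s); rewrite ?word_cons //= sn.
  by exists (false :: s); rewrite ?word_cons //= sn.
exists (fun i => if nth true s i then opA R else opB R).
  by move=> i; case: nth; [left|right].
by rewrite /word (big_nth true) big_mkord.
Qed.

End Words.

Section Pieces.
Variables (R : realType) (Delta : R).
Hypothesis Delta_gt0 : 0 < Delta.
Implicit Types (f g : 'cV[R]_3) (r : rat) (n i : nat) (C : set 'cV[R]_3).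

Local Notation F f r := (form_eval f (ratr r) (-1)).
Local Notation AB := (word (@opA R) (@opB R)).

Lemma form_eval_gt0 f x y : G_A Delta f -> 0 <= x * y -> x != 0 -> 0 < form_eval f x y.
Proof.
move=> /G_AE[_ m0 n0 k0] xy x0; have x2 : 0 < x ^+ 2 by rewrite exprn_even_gt0.
have y2 := sqr_ge0 y.
rewrite /form_eval; apply: ltr_wpDr; first by rewrite mulr_ge0 // ltW.
by apply: ltr_wpDr; [rewrite mulr_ge0 // ltW|exact: mulr_gt0].
Qed.

(** The common part of the recursions for A and B. The functions u and v stand
for r |-> f(r, -1) before and after the operator is applied, p for the map by
which the operator moves intervals and q for the other map; the values at q r
and at 1 are positive because the moved interval lies in the image of the
positive half-line under p, strictly on one side of 1. *)
Lemma generation_shift n (u v : rat -> R) (p q : rat -> rat) :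
  (forall i, pos_generation i.+1 = p @` pos_generation i `|` q @` pos_generation i) ->
  (forall r, 0 < r -> (v (p r) < 0 <-> u r < 0) /\ (0 < v (p r) <-> 0 < u r)) ->
  (forall r, 0 < r -> 0 < v (q r)) -> 0 < v 1 ->
  ((exists2 r, pos_generation n.+1 r & v r < 0) /\
   (forall i r, (i < n.+1)%N -> pos_generation i r -> 0 < v r)) <->
  ((exists2 r, pos_generation n r & u r < 0) /\
   (forall i r, (i < n)%N -> pos_generation i r -> 0 < u r)).
Proof.
move=> pq vp vq v1; split=> -[[r rn rv] pos].
  split=> [|i s lt_in si].
    move: rn rv; rewrite pq => -[] [s sn <-]; have s0 := pos_generation_gt0 sn.
      by move/(vp s s0).1; exists s.
    by rewrite ltNge (ltW (vq s s0)).
  apply/(vp s (pos_generation_gt0 si)).2/(pos i.+1) => //.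
  by rewrite pq; left; exists s.
split=> [|[|i] s lt_in].
- exists (p r); first by rewrite pq; left; exists r.
  exact/(vp r (pos_generation_gt0 rn)).1.
- by move->.
rewrite pq => -[] [t ti <-]; have t0 := pos_generation_gt0 ti; last exact: vq.
exact/(vp t t0).2/(pos i).
Qed.

Lemma hyperboloid_opA f : hyperboloid Delta (opA R *m f) <-> hyperboloid Delta f.
Proof.
have [m1 n1 k1] := opA_coord f.
by split=> /hyperboloidE h; apply/hyperboloidE; rewrite -h m1 n1 k1; ring.
Qed.

Lemma hyperboloid_opB f : hyperboloid Delta (opB R *m f) <-> hyperboloid Delta f.
Proof.
have [m1 n1 k1] := opB_coord f.
by split=> /hyperboloidE h; apply/hyperboloidE; rewrite -h m1 n1 k1; ring.
Qed.

Lemma G_A_opA f : G_A Delta f -> G_A Delta (opA R *m f).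
Proof.
move=> /G_AE[hf m0 n0 k0]; apply/G_AE; have [-> -> ->] := opA_coord f.
by split; [exact/hyperboloid_opA|lra..].
Qed.

Lemma G_A_opB f : G_A Delta f -> G_A Delta (opB R *m f).
Proof.
move=> /G_AE[hf m0 n0 k0]; apply/G_AE; have [-> -> ->] := opB_coord f.
by split; [exact/hyperboloid_opB|lra..].
Qed.

Lemma gen_domain_opA n f : G_A Delta f ->
  gen_domain Delta n.+2 (opA R *m f) <-> gen_domain Delta n.+1 f.
Proof.
move=> Gf; rewrite (gen_domain_G_AE Delta_gt0 _ (G_A_opA Gf)).
rewrite (gen_domain_G_AE Delta_gt0 _ Gf).
apply: (@generation_shift n (fun r => F f r) (fun r => F (opA R *m f) r)
  (fun r => r + 1) (fun r => r / (r + 1))) => [//|r r0|r r0|].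
- by rewrite form_eval_opA rmorphD rmorph1 addrK.
- have r0' : 0 < ratr r :> R by rewrite ltr0q.
  rewrite form_eval_opA fmorph_div rmorphD rmorph1.
  rewrite (_ : _ + -1 = - (ratr r + 1)^-1); last by field; rewrite gt_eqF ?addr_gt0.
  apply: form_eval_gt0 => //; last by rewrite oppr_eq0 invr_eq0 gt_eqF ?addr_gt0.
  by rewrite mulrNN mulr1 invr_ge0 addr_ge0 // ltW.
- have /G_AE[_ m0 n0 k0] := Gf.
  by rewrite form_eval_opA rmorph1 subrr /form_eval; lra.
Qed.

Lemma gen_domain_opB n f : G_A Delta f ->
  gen_domain Delta n.+2 (opB R *m f) <-> gen_domain Delta n.+1 f.
Proof.
move=> Gf; rewrite (gen_domain_G_AE Delta_gt0 _ (G_A_opB Gf)).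
rewrite (gen_domain_G_AE Delta_gt0 _ Gf).
apply: (@generation_shift n (fun r => F f r) (fun r => F (opB R *m f) r)
  (fun r => r / (r + 1)) (fun r => r + 1)) => [i|r r0|r r0|].
- by rewrite /= setUC.
- have r1 : 0 < ratr r + 1 :> R by rewrite addr_gt0 // ltr0q.
  rewrite form_eval_opB fmorph_div rmorphD rmorph1.
  have -> : form_eval f (ratr r / (ratr r + 1)) (ratr r / (ratr r + 1) - 1) =
      ((ratr r + 1) ^- 2) * F f r.
    by rewrite /form_eval; field; rewrite gt_eqF.
  by rewrite pmulr_rlt0 ?pmulr_rgt0 // invr_gt0 exprn_gt0.
- have r0' : 0 < ratr r :> R by rewrite ltr0q.
  rewrite form_eval_opB rmorphD rmorph1 addrK.
  apply: form_eval_gt0 => //; last by rewrite gt_eqF ?addr_gt0.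
  by rewrite mulr_ge0 ?addr_ge0 // ltW.
- have /G_AE[_ m0 n0 k0] := Gf.
  by rewrite form_eval_opB rmorph1 subrr /form_eval; lra.
Qed.

Lemma gen_domain1_G_A f : G_A Delta f -> gen_domain Delta 1 f <-> H_A Delta f.
Proof.
move=> Gf; have /G_AE[hf m0 n0 k0] := Gf; rewrite (gen_domain_G_AE Delta_gt0 _ Gf).
split=> [[[_ -> /=]] + _|/H_AE[_ _ _ mnk]].
  by rewrite rmorph1 /form_eval => ?; apply/H_AE; split=> //; lra.
by split=> //; exists 1 => //; rewrite rmorph1 /form_eval; lra.
Qed.

Lemma H_A_sub_G_A : H_A Delta `<=` G_A Delta.
Proof. by move=> f /H_AE[? ? ? ?]; apply/G_AE; split=> //; lra. Qed.

(** The coefficient k of a form in the preimage of G_A under A or B is positive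
because otherwise the other inequalities would make the form definite: k^2 <
2mn. *)
Lemma indefinite_gt0 (m n k : R) : 0 < k ^+ 2 - 4 * m * n ->
  0 < n -> 0 < k + 2 * m -> 0 < n + k -> 0 < k.
Proof.
move=> d n0 km nk; rewrite ltNge; apply/negP => k_le0.
have h1 : 0 < (2 * m + k) * n by rewrite mulr_gt0 //; lra.
have h2 : 0 <= (n + k) * - k by rewrite mulr_ge0 //; lra.
have h3 := sqr_ge0 k.
have h4 : k ^+ 2 - 4 * m * n =
  - (2 * ((2 * m + k) * n)) - 2 * ((n + k) * - k) - k ^+ 2 by ring.
lra.
Qed.

(** If the interval of f avoids 1, then it lies on the side x > 1 exactly when m
< n, and translating it by -1 keeps it positive. *)
Lemma G_A_opA_preimage f : G_A Delta f -> 0 < F f 1 -> cm f < cn f ->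
  G_A Delta ((opA R)^-1 *m f).
Proof.
move=> Gf; set g := _ *m f; have fE : f = opA R *m g.
  by rewrite /g -mulop_act mulrV ?opA_unit // mul1mx.
clearbody g; move: Gf; rewrite {f}fE => /G_AE[/hyperboloid_opA hg].
rewrite rmorph1 /form_eval; have [-> -> ->] := opA_coord g => m0 n0 k0 f1 mn.
have /hyperboloidE kg := hg.
have cn_gt0 : 0 < cn g by lra.
have k_gt0 : 0 < ck g.
  by apply: (@indefinite_gt0 (cm g) (cn g)); [rewrite kg|lra..].
by apply/G_AE; split=> //; lra.
Qed.

Lemma G_A_opB_preimage f : G_A Delta f -> 0 < F f 1 -> cn f < cm f ->
  G_A Delta ((opB R)^-1 *m f).
Proof.
move=> Gf; set g := _ *m f; have fE : f = opB R *m g.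
  by rewrite /g -mulop_act mulrV ?opB_unit // mul1mx.
clearbody g; move: Gf; rewrite {f}fE => /G_AE[/hyperboloid_opB hg].
rewrite rmorph1 /form_eval; have [-> -> ->] := opB_coord g => m0 n0 k0 f1 mn.
have /hyperboloidE kg := hg.
have cm_gt0 : 0 < cm g by lra.
have k_gt0 : 0 < ck g.
  by apply: (@indefinite_gt0 (cn g) (cm g)); [rewrite mulrAC kg|lra..].
by apply/G_AE; split=> //; lra.
Qed.

Lemma H_A_center : H_A Delta (mkform 1 1 (Num.sqrt (Delta + 4))).
Proof.
have D0 := Delta_gt0.
have k2 : Num.sqrt (Delta + 4) ^+ 2 = Delta + 4 by rewrite sqr_sqrtr; lra.
have := sqrtr_ge0 (Delta + 4); set k := Num.sqrt _ in k2 * => k0.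
have [m1 n1 k1] := mkform_coord 1 1 k.
apply/H_AE; rewrite m1 n1 k1; split=> //.
  by apply/hyperboloidE; rewrite m1 n1 k1 k2; ring.
by rewrite ltNge; apply/negP => k_le2; nra.
Qed.

(** In the coordinates (m, n), with k = sqrt (Delta + 4mn), the set H_A becomes
the convex region m > 0, n > 0, |m - n| < sqrt Delta. It is therefore the union
of the curves that lift the segments from the point (1, 1). *)
Lemma H_A_connected : connected (H_A Delta).
Proof.
pose path f t := mkform (1 + t * (cm f - 1)) (1 + t * (cn f - 1))
  (Num.sqrt (Delta + 4 * (1 + t * (cm f - 1)) * (1 + t * (cn f - 1)))).
have path0 f : path f 0 = mkform 1 1 (Num.sqrt (Delta + 4)).
  by rewrite /path !mul0r !addr0 !mulr1.
have path1 f : H_A Delta f -> path f 1 = f.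
  move=> /H_AE[/hyperboloidE kf m0 n0 mnk]; rewrite /path !mul1r !subrKC.
  have [m1 n1 k1] := mkform_coord (cm f) (cn f) (Num.sqrt (Delta + 4 * cm f * cn f)).
  apply: form_ext => //; rewrite k1 -kf subrK sqrtr_sqr ger0_norm //; lra.
have coord_cont c : continuous (fun t : R => 1 + t * c).
  move=> t; apply: cvgD; first exact: cvg_cst.
  by apply: cvgMr_tmp; exact: cvg_id.
have path_cont f : continuous (path f).
  apply: mkform_continuous => // t; apply: continuous_comp; last exact: sqrt_continuous.
  apply: cvgD; first exact: cvg_cst.
  apply: cvgM; last exact: coord_cont.
  by apply: cvgMl_tmp; exact: coord_cont.
have path_in f t : H_A Delta f -> 0 <= t <= 1 -> H_A Delta (path f t).
  move=> /H_AE[/hyperboloidE kf m0 n0 mnk] /andP[t0 t1]; rewrite /path.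
  set m := 1 + t * _; set n := 1 + t * _.
  have mt : 0 < m by rewrite /m; nra.
  have nt : 0 < n by rewrite /n; nra.
  (* On the hyperboloid this bound is equivalent to (m + n)^2 < k^2. *)
  have mn : (m - n) ^+ 2 < Delta.
    rewrite (_ : m - n = t * (cm f - cn f)); last by rewrite /m /n; ring.
    rewrite exprMn; apply: (@le_lt_trans _ _ ((cm f - cn f) ^+ 2)).
      by rewrite ler_piMl ?sqr_ge0 // expr_le1.
    rewrite -kf (_ : _ ^+ 2 = (cm f + cn f) ^+ 2 - 4 * cm f * cn f); last by ring.
    by rewrite ltrD2r ltr_pXn2r // nnegrE; lra.
  have k2 : Num.sqrt (Delta + 4 * m * n) ^+ 2 = Delta + 4 * m * n.
    by rewrite sqr_sqrtr // addr_ge0 ?ltW // !mulr_gt0.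
  have := sqrtr_ge0 (Delta + 4 * m * n); set k := Num.sqrt _ in k2 * => k0.
  have [m1 n1 k1] := mkform_coord m n k.
  apply/H_AE; rewrite m1 n1 k1; split=> //.
    by apply/hyperboloidE; rewrite m1 n1 k1 k2; ring.
  rewrite -(@ltr_pXn2r _ 2) ?nnegrE //; last by lra.
  rewrite k2 -subr_gt0 (_ : _ - _ = Delta - (m - n) ^+ 2) ?subr_gt0 //; ring.
rewrite (_ : H_A Delta = \bigcup_(f in H_A Delta) (path f @` `[0, 1])).
  apply: bigcup_connected.
    exists (mkform 1 1 (Num.sqrt (Delta + 4))) => f _.
    by exists 0; rewrite ?path0 //= in_itv /= lexx ler01.
  move=> f _; apply: connected_continuous_connected; first exact: segment_connected.
  exact: continuous_subspaceT.
apply/seteqP; split=> [f Hf|_ [f Hf [t t01 <-]]].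
  by exists f => //; exists 1; rewrite ?path1 //= in_itv /= lexx ler01.
by apply: path_in => //; rewrite /= in_itv /= in t01.
Qed.

(** On a domain of positive generation none of m, n, k vanishes, since mn > 0
and k^2 = Delta + 4mn, so their signs are constant on connected subsets. *)
Lemma connected_in_G_A n C f : connected C -> C `<=` gen_domain Delta n.+1 ->
  C f -> G_A Delta f -> C `<=` G_A Delta.
Proof.
move=> Cc CX Cf /G_AE[_ m0 n0 k0].
have mn g : C g -> 0 < cm g * cn g by move/CX; exact: gen_domain_definite.
have pos (u : 'cV[R]_3 -> R) : continuous u -> (forall g, C g -> u g != 0) ->
    0 < u f -> forall g, C g -> 0 < u g.
  move=> uc u0 uf; have [//|un] := connected_sign uc Cc u0.
  by have := un f Cf; rewrite ltNge (ltW uf).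
move=> g Cg; apply/G_AE; split.
- exact: gen_domain_hyperboloid (CX g Cg).
- apply: (pos _ (@cm_continuous R)) Cg => // h /mn.
  by apply: contraTneq => ->; rewrite mul0r ltxx.
- apply: (pos _ (@cn_continuous R)) Cg => // h /mn.
  by apply: contraTneq => ->; rewrite mulr0 ltxx.
- apply: (pos _ (@ck_continuous R)) Cg => // h Ch.
  have /hyperboloidE kh := gen_domain_hyperboloid (CX h Ch).
  have D0 := Delta_gt0; have := mn h Ch; apply: contraTneq => k1.
  by rewrite k1 in kh; rewrite -leNgt; lra.
Qed.

(** A form of generation at least 2 satisfies f(1, -1) > 0 and hence n <> m, so
a connected set of such forms lies wholly on one of the sides n > m and n < m;
pulling it back by A or B accordingly gives a connected set one generation
earlier. *)
Lemma connected_in_word n C : connected C -> C `<=` gen_domain Delta n.+1 ->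
  C `<=` G_A Delta -> exists2 s, size s = n & C `<=` act (AB s) (H_A Delta).
Proof.
elim: n C => [|n IH] C Cc CX CG.
  exists [::] => // f Cf; rewrite /word big_nil act1.
  by apply/(gen_domain1_G_A (CG f Cf)); exact: CX.
have F1 f : C f -> 0 < F f 1.
  move=> Cf; have [_ /(_ 0%N 1)] := (gen_domain_G_AE Delta_gt0 _ (CG f Cf)).1 (CX f Cf).
  exact.
have step T b : T \is a GRing.unit -> (forall s, AB (b :: s) = T * AB s) ->
    (forall f, G_A Delta f ->
       gen_domain Delta n.+2 (T *m f) <-> gen_domain Delta n.+1 f) ->
    (forall f, C f -> G_A Delta (T^-1 *m f)) ->
    exists2 s, size s = n.+1 & C `<=` act (AB s) (H_A Delta).
  move=> Tu TE TX TG; have [||s sn sub] := IH (act T^-1 C) (act_connected Cc).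
  - move=> _ [f Cf <-]; apply/TX; first exact: TG.
    by rewrite -mulop_act mulrV // mul1mx; exact: CX.
  - by move=> _ [f Cf <-]; exact: TG.
  exists (b :: s); first by rewrite /= sn.
  move=> f Cf; rewrite TE actM; exists (T^-1 *m f); last first.
    by rewrite -mulop_act mulrV // mul1mx.
  by apply: sub; exists f.
have dc : continuous (fun f : 'cV[R]_3 => cn f - cm f).
  rewrite (_ : (fun _ => _) = fun f => -1 * cm f + 1 * cn f + 0 * ck f).
    exact: linear_form_continuous.
  by apply/funext => f; ring.
have [f Cf| |] := connected_sign dc Cc.
(* If m = n, then f(1, -1) > 0 means k < 2m, and the discriminant is negative. *)
- have := F1 f Cf; rewrite rmorph1 /form_eval.
  have /G_AE[/hyperboloidE kf ? ? ?] := CG f Cf.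
  move=> f1; apply/negP => /eqP/subr0_eq d0; have D0 := Delta_gt0.
  by move: kf f1; rewrite d0 => kf f1; nra.
- move=> d_gt0; apply: (step (opA R) true) => //.
  + exact: opA_unit.
  + by move=> s; rewrite word_cons.
  + by move=> f; exact: gen_domain_opA.
  by move=> f Cf; apply: G_A_opA_preimage;
    [exact: CG|exact: F1|rewrite -subr_gt0; exact: d_gt0].
- move=> d_lt0; apply: (step (opB R) false) => //.
  + exact: opB_unit.
  + by move=> s; rewrite word_cons.
  + by move=> f; exact: gen_domain_opB.
  by move=> f Cf; apply: G_A_opB_preimage;
    [exact: CG|exact: F1|rewrite -subr_lt0; exact: d_lt0].
Qed.

Lemma word_gen_domain s f : H_A Delta f ->
  gen_domain Delta (size s).+1 (AB s *m f) /\ G_A Delta (AB s *m f).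
Proof.
move=> Hf; elim: s => [|c s [IHX IHG]].
  have Gf := H_A_sub_G_A Hf.
  by rewrite /word big_nil mul1mx; split=> //; exact/gen_domain1_G_A.
rewrite word_cons mulop_act; case: c.
  by split; [exact/gen_domain_opA|exact: G_A_opA].
by split; [exact/gen_domain_opB|exact: G_A_opB].
Qed.

(** The last operator of a product can be read off the form: a form in A G_A or
B G_A has its interval on one side of 1, given by the sign of n - m, whereas the
interval of a form in H_A contains 1. *)
Lemma letter_sign (c : bool) g : G_A Delta g ->
  let h := (if c then opA R else opB R) *m g in
  ck h < cm h + cn h /\ (cm h < cn h) = c.
Proof.
move=> /G_AE[_ m0 n0 k0]; case: c => /=.
  have [-> -> ->] := opA_coord g; split; first by lra.
  by apply/idP; lra.
have [-> -> ->] := opB_coord g; split; first by lra.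
by apply/negbTE; rewrite -leNgt; lra.
Qed.

(** The first letter of a nonempty word is recovered from the signs in
[letter_sign], which also tell a nonempty word from the empty one. *)
Lemma word_inj s t f g : H_A Delta f -> H_A Delta g -> AB s *m f = AB t *m g -> s = t.
Proof.
have nil_cons c u h l : H_A Delta h -> H_A Delta l -> h <> AB (c :: u) *m l.
  move=> /H_AE[_ _ _ hk] Hl hE; move: hk; rewrite hE word_cons mulop_act.
  have [+ _] := letter_sign c (word_gen_domain u Hl).2.
  by move=> /lt_trans/[apply]; rewrite ltxx.
move=> Hf Hg; elim: s t => [|c s IH] [|d t] //.
- by rewrite {1}/word big_nil mul1mx => /nil_cons; case.
- by rewrite {2}/word big_nil mul1mx => /esym/nil_cons; case.
rewrite !word_cons !mulop_act => E.
have [_ cE] := letter_sign c (word_gen_domain s Hf).2.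
have [_ dE] := letter_sign d (word_gen_domain t Hg).2.
have cd : c = d by rewrite -cE -dE E.
rewrite -cd in E *; congr (_ :: _); apply: IH.
set l := (if c then _ else _) in E.
have cu : l \is a GRing.unit.
  by rewrite /l; case: (c); [exact: opA_unit|exact: opB_unit].
by have := congr1 (mulmx l^-1) E; rewrite -!mulop_act !mulrA mulVr // !mul1r.
Qed.

Lemma component_word s f : H_A Delta f ->
  connected_component (gen_domain Delta (size s).+1) (AB s *m f) =
  act (AB s) (H_A Delta).
Proof.
move=> Hf; have [fX fG] := word_gen_domain s Hf.
apply/seteqP; split; last first.
  apply: connected_component_max; first by exists f.
    by move=> _ [g Hg <-]; exact: (word_gen_domain s Hg).1.
  exact/act_connected/H_A_connected.
have Cf := connected_component_refl fX.
have Cc := @component_connected _ (gen_domain Delta (size s).+1) (AB s *m f).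
have CX := @connected_component_sub _ (gen_domain Delta (size s).+1) (AB s *m f).
have [t tn sub] := connected_in_word Cc CX (connected_in_G_A Cc CX Cf fG).
have [g Hg gf] := sub _ Cf.
by rewrite -(word_inj Hf Hg (esym gf)) in sub.
Qed.

Lemma domain_components_G_A n : domain_components Delta n.+1 (G_A Delta) =
  [set act (AB s) (H_A Delta) | s in [set s | size s = n]].
Proof.
apply/seteqP; split=> [C [[f fX <-] CG]|_ [s <- <-]].
  have [s sn sub] := connected_in_word (@component_connected _ _ f)
    (@connected_component_sub _ _ f) CG.
  have [g Hg gf] := sub _ (connected_component_refl fX).
  by exists s => //; rewrite -(component_word _ Hg) sn gf.
have [fX fG] := word_gen_domain s H_A_center.
split; first by exists (AB s *m mkform 1 1 (Num.sqrt (Delta + 4))) => //;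
  exact: component_word H_A_center.
by move=> _ [g Hg <-]; exact: (word_gen_domain s Hg).2.
Qed.

End Pieces.

(** * Symmetries and the other quadrants *)

Section Symmetries.
Variables (R : realType) (Delta : R).
Hypothesis Delta_gt0 : 0 < Delta.
Implicit Types (f g : 'cV[R]_3) (n : nat) (s : seq bool) (T U : 'M[R]_3).

Local Notation AB := (word (@opA R) (@opB R)).
Local Notation J := (opJ R).

Definition gen_domain_symmetry T := T * T = 1 /\
  forall n f, gen_domain Delta n.+1 f -> gen_domain Delta n.+1 (T *m f).

(** A linear involution is a homeomorphism, so it preserves the closures of
generations as soon as it preserves the generations. *)
Lemma gen_domain_symmetryP T : T * T = 1 ->
  (forall f, hyperboloid Delta f -> hyperboloid Delta (T *m f)) ->
  (forall n f, Hgen Delta n f -> Hgen Delta n (T *m f)) -> gen_domain_symmetry T.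
Proof.
move=> TT Th TH; split=> // n f [fn nfn]; split; first exact: TH.
case=> _ [j jn [_ fj]]; apply: nfn; split=> //; exists j => //.
have fE : T *m (T *m f) = f by rewrite -mulop_act TT mul1mx.
split; first by case: fn => -[r|] _ [].
rewrite -fE; apply: closureS (act_closure fj) => _ [g gj <-].
exact: TH.
Qed.

Lemma gen_domain_symmetryM T U : T * U = U * T ->
  gen_domain_symmetry T -> gen_domain_symmetry U -> gen_domain_symmetry (T * U).
Proof.
move=> TU [TT TX] [UU UX]; split.
  by rewrite {1}TU -mulrA [T * (_ * _)]mulrA TT mul1r.
by move=> n f fX; rewrite mulop_act; exact/TX/UX.
Qed.

Lemma symmetry1 : gen_domain_symmetry 1.
Proof. by split; [rewrite mulr1|move=> n f; rewrite mul1mx]. Qed.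

(** The substitution f(x, -y) sends the rhombus of r to the rhombus of -r. *)
Lemma symmetryJ : gen_domain_symmetry J.
Proof.
have hJ f : hyperboloid Delta f -> hyperboloid Delta (J *m f).
  have [m1 n1 k1] := opJ_coord f.
  by move=> /hyperboloidE h; apply/hyperboloidE; rewrite m1 n1 k1 sqrrN.
apply: gen_domain_symmetryP => // [|[|n] f]; first exact: opJK.
  move=> /Hgen0E[hf mn]; apply/Hgen0E; split; first exact: hJ.
  by have [-> -> _] := opJ_coord f.
case=> _ [r rn <-] /rhombus_ratE[hf f1 f2].
exists (Some (- r)); first by exists (- r) => //=; rewrite normrN.
have [m1 n1 k1] := opJ_coord f.
apply/rhombus_ratE; split; first exact: hJ.
  by move: f1; rewrite /form_eval m1 n1 k1 rmorphN; congr (_ < _); ring.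
by move: f2; rewrite /form_eval m1 n1 k1 rmorphN; congr (_ < _); ring.
Qed.

(** The opposite of a form in the rhombus of r lies in the rhombus of -1/r. *)
Lemma symmetryN : gen_domain_symmetry (-1).
Proof.
have NE f : -1 *m f = - f by rewrite mulNmx mul1mx.
have hN f : hyperboloid Delta f -> hyperboloid Delta (- f).
  have [m1 n1 k1] := opp_coord f.
  move=> /hyperboloidE h; apply/hyperboloidE; rewrite m1 n1 k1 -h; ring.
apply: gen_domain_symmetryP => [|f|[|n] f]; rewrite ?NE.
- by rewrite mulrNN mulr1.
- exact: hN.
- move=> /Hgen0E[hf mn]; apply/Hgen0E; split; first exact: hN.
  by have [-> -> _] := opp_coord f; rewrite mulrNN.
case=> _ [r /= rn <-] /rhombus_ratE[hf f1 f2].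
have r0 : ratr r != 0 :> R.
  by rewrite fmorph_eq0 -normr_eq0 gt_eqF // (pos_generation_gt0 rn).
exists (Some (- r^-1)).
  by exists (- r^-1) => //=; rewrite normrN normfV; exact: pos_generationV.
have [m1 n1 k1] := opp_coord f.
have r2 : 0 < (ratr r : R) ^- 2 by rewrite invr_gt0 exprn_even_gt0.
apply/rhombus_ratE; rewrite rmorphN fmorphV; split; first exact: hN.
  rewrite (_ : form_eval _ _ _ = - (ratr r ^- 2 * form_eval f (ratr r) (-1))).
    by rewrite oppr_gt0 pmulr_rlt0.
  by rewrite /form_eval m1 n1 k1; field.
rewrite (_ : form_eval _ _ _ = - (ratr r ^- 2 * form_eval f 1 (ratr r))).
  by rewrite oppr_lt0 pmulr_rgt0.
by rewrite /form_eval m1 n1 k1; field.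
Qed.

Lemma act_involution T (X Y : set 'cV[R]_3) : T * T = 1 ->
  (forall f, X (T *m f) <-> Y f) -> Y = act T X.
Proof.
move=> TT XY; have TTf f : T *m (T *m f) = f by rewrite -mulop_act TT mul1mx.
apply/seteqP; split=> [f /XY Xf|_ [f Xf <-]]; first by exists (T *m f).
by apply/XY; rewrite TTf.
Qed.

Lemma domain_components_act T n (G : set 'cV[R]_3) : gen_domain_symmetry T ->
  domain_components Delta n.+1 (act T G) =
  act T @` domain_components Delta n.+1 G.
Proof.
move=> [TT TX].
have actTT X : act T (act T X) = X by rewrite -actM TT act1.
have XE : act T (gen_domain Delta n.+1) = gen_domain Delta n.+1.
  by apply/esym/act_involution => // f; split=> /TX; rewrite -?mulop_act ?TT ?mul1mx.
have sub K C : domain_components Delta n.+1 K C ->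
    domain_components Delta n.+1 (act T K) (act T C).
  move=> [[f fX <-] CK]; split; last by move=> _ [g /CK Kg <-]; exists g.
  by exists (T *m f); [exact: TX|exact: act_connected_component].
apply/seteqP; split=> [C /sub|_ [C /sub + <-] //].
by rewrite actTT => dC; exists (act T C).
Qed.

(** Stated with the conjugates T W T of words W, because these are the operators
that act on the quadrant T G_A. *)
Lemma domain_components_word T n : gen_domain_symmetry T ->
  domain_components Delta n.+1 (act T (G_A Delta)) =
  [set act (T * AB s * T) (act T (H_A Delta)) | s in [set s | size s = n]].
Proof.
move=> TS; have [TT _] := TS.
have E s : act (T * AB s * T) (act T (H_A Delta)) = act T (act (AB s) (H_A Delta)).
  by rewrite -!actM -!mulrA TT mulr1.
rewrite (domain_components_act _ _ TS) (domain_components_G_A Delta_gt0).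
apply/seteqP; split=> [_ [_ [s sn <-] <-]|_ [s sn <-]].
  by exists s.
by rewrite E; exists (act (AB s) (H_A Delta)) => //; exists s.
Qed.

Lemma all_components_bij T (W : seq bool -> 'M[R]_3) : gen_domain_symmetry T ->
  (forall s, W s = T * AB s * T) ->
  set_bij (range W) (all_domain_components Delta (act T (G_A Delta)))
    (fun U => act U (act T (H_A Delta))).
Proof.
move=> TS WE; have [TT _] := TS; split.
- move=> _ [s _ <-]; exists (size s).+1 => //.
  by rewrite (domain_components_word _ TS) WE; exists s.
- move=> _ _ /set_mem[s _ <-] /set_mem[t _ <-].
  rewrite !WE -!actM -!mulrA TT !mulr1 !actM => /(congr1 (act T)).
  rewrite -!(actM T T) TT !act1 => st.
  have [g Hg gE] : act (AB t) (H_A Delta) (AB s *m mkform 1 1 (Num.sqrt (Delta + 4))).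
    by rewrite -st; exists (mkform 1 1 (Num.sqrt (Delta + 4))) => //; exact: H_A_center.
  by rewrite (word_inj Delta_gt0 (H_A_center Delta_gt0) Hg (esym gE)).
- move=> C [[//|n] _]; rewrite (domain_components_word _ TS) => -[s _ <-].
  by exists (W s); [exists s|rewrite WE].
Qed.

Lemma word_conj T (a b : 'M[R]_3) s : T * T = 1 ->
  word (T * a * T) (T * b * T) s = T * word a b s * T.
Proof.
move=> TT; elim: s => [|c s IH]; first by rewrite /word !big_nil mulr1.
rewrite !word_cons IH -(if_arg c) !mulrA.
by case: c; rewrite -!mulrA (mulrA T T) TT mul1r.
Qed.

Lemma wordV (a b : 'M[R]_3) s : a \is a GRing.unit -> b \is a GRing.unit ->
  (word a b s)^-1 = word a^-1 b^-1 (rev s).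
Proof.
move=> au bu; have wu t : word a b t \is a GRing.unit.
  elim: t => [|c t IH]; first by rewrite /word big_nil unitr1.
  by rewrite word_cons unitrMl //; case: c.
elim: s => [|c s IH]; first by rewrite /word !big_nil invr1.
rewrite word_cons invrM //; last by case: c.
rewrite IH rev_cons /word big_rcons /= -/(word _ _ _).
by case: c.
Qed.

Lemma G_AbarE : G_Abar Delta = act J (G_A Delta).
Proof.
apply: act_involution (opJK R) _ => f; rewrite /G_A /G_Abar /=.
have [m1 n1 k1] := opJ_coord f.
rewrite /hyperboloid /= /cD /cS /cK m1 n1 k1 sqrrN oppr_gt0.
by split.
Qed.

Lemma H_AbarE : H_Abar Delta = act J (H_A Delta).
Proof.
apply: act_involution (opJK R) _ => f; rewrite /H_A /H_Abar /HK /=.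
have [m1 n1 k1] := opJ_coord f.
by rewrite /hyperboloid /= /cD /cS /cK m1 n1 k1 sqrrN oppr_gt0 normrN.
Qed.

Lemma act_opp_coord f : let g := (-1 : 'M[R]_3) *m f in
  [/\ cK g = - cK f, cD g = - cD f & cS g = - cS f].
Proof.
rewrite mulNmx mul1mx /cK /cD /cS; have [-> -> ->] := opp_coord f.
by split=> //; ring.
Qed.

Lemma oppK : (-1 : 'M[R]_3) * -1 = 1.
Proof. by rewrite mulrNN mulr1. Qed.

Lemma G_BE : G_B Delta = act (-1) (G_A Delta).
Proof.
apply: act_involution oppK _ => f; rewrite /G_A /G_B /hyperboloid /=.
have [-> -> ->] := act_opp_coord f.
by rewrite !sqrrN !normrN oppr_gt0 ltrNr.
Qed.

Lemma H_BE : H_B Delta = act (-1) (H_A Delta).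
Proof.
apply: act_involution oppK _ => f; rewrite /H_A /H_B /HK /hyperboloid /=.
have [-> -> ->] := act_opp_coord f.
by rewrite !sqrrN !normrN !oppr_gt0.
Qed.

Lemma G_BbarE : G_Bbar Delta = act (-1 * J) (G_A Delta).
Proof.
rewrite actM -G_AbarE; apply: act_involution oppK _ => f.
rewrite /G_Abar /G_Bbar /hyperboloid /=.
have [-> -> ->] := act_opp_coord f.
by rewrite !sqrrN !normrN oppr_lt0 ltrNr.
Qed.

Lemma H_BbarE : H_Bbar Delta = act (-1 * J) (H_A Delta).
Proof.
rewrite actM -H_AbarE; apply: act_involution oppK _ => f.
rewrite /H_Abar /H_Bbar /HK /hyperboloid /=.
have [-> -> ->] := act_opp_coord f.
by rewrite !sqrrN !normrN !oppr_lt0 !oppr_gt0.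
Qed.

End Symmetries.

Theorem theorem4p2 (R : realType) (Delta : R) (Delta_gt0 : 0 < Delta) :
  [/\ set_bij (@Tplus R) (all_domain_components Delta (G_A Delta))
        (fun T => act T (H_A Delta)),
      set_bij (@Tplus R) (all_domain_components Delta (G_B Delta))
        (fun T => act T (H_B Delta)),
      set_bij (@Tminus R) (all_domain_components Delta (G_Abar Delta))
        (fun T => act T (H_Abar Delta))
    & set_bij (@Tminus R) (all_domain_components Delta (G_Bbar Delta))
        (fun T => act T (H_Bbar Delta))] /\
  forall n : nat,
  [/\ [set act T (H_A Delta) | T in Tplus_products n]
        = domain_components Delta n.+1 (G_A Delta),
      [set act T (H_B Delta) | T in Tplus_products n]
        = domain_components Delta n.+1 (G_B Delta),
      [set act T^-1 (H_Abar Delta) | T in Tplus_products n]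
        = domain_components Delta n.+1 (G_Abar Delta)
    & [set act T^-1 (H_Bbar Delta) | T in Tplus_products n]
        = domain_components Delta n.+1 (G_Bbar Delta)].
Proof.
pose V := word (opA R)^-1 (opB R)^-1.
have symN := symmetryN Delta; have symJ := symmetryJ Delta.
have symNJ : gen_domain_symmetry Delta (-1 * opJ R).
  by apply: gen_domain_symmetryM => //; rewrite mulN1r mulrN1.
have W1 s : word (opA R) (opB R) s = 1 * word (opA R) (opB R) s * 1.
  by rewrite mul1r mulr1.
have WN s : word (opA R) (opB R) s = -1 * word (opA R) (opB R) s * -1.
  by rewrite mulN1r mulrN1 opprK.
have VJ s : V s = opJ R * word (opA R) (opB R) s * opJ R.
  by rewrite /V -opJ_conjA -opJ_conjB word_conj ?opJK.
have VNJ s : V s = (-1 * opJ R) * word (opA R) (opB R) s * (-1 * opJ R).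
  by rewrite VJ !mulN1r mulrN !mulNr opprK.
rewrite G_BE H_BE G_AbarE H_AbarE G_BbarE H_BbarE.
have HA1 := act1 (H_A Delta); have GA1 := act1 (G_A Delta).
split.
  rewrite /Tplus /Tminus !smallest_semigroup_word -{1}HA1 -{1}GA1.
  split; [exact: all_components_bij (symmetry1 Delta) W1|exact: all_components_bij symN WN
    |exact: all_components_bij symJ VJ|exact: all_components_bij symNJ VNJ].
have plus T n : gen_domain_symmetry Delta T ->
    (forall s, word (opA R) (opB R) s = T * word (opA R) (opB R) s * T) ->
    [set act U (act T (H_A Delta)) | U in Tplus_products n] =
    domain_components Delta n.+1 (act T (G_A Delta)).
  move=> TS WE; rewrite (domain_components_word Delta_gt0 _ TS) Tplus_products_word.
  by rewrite image_comp; apply: eq_imagel => s _ /=; rewrite -WE.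
have minus T n : gen_domain_symmetry Delta T ->
    (forall s, V s = T * word (opA R) (opB R) s * T) ->
    [set act U^-1 (act T (H_A Delta)) | U in Tplus_products n] =
    domain_components Delta n.+1 (act T (G_A Delta)).
  move=> TS WE; rewrite (domain_components_word Delta_gt0 _ TS) Tplus_products_word.
  apply/seteqP; split=> [_ [_ [s sn <-] <-]|_ [s sn <-]].
    exists (rev s); first by rewrite /= size_rev.
    by rewrite -WE wordV ?opA_unit ?opB_unit.
  exists (word (opA R) (opB R) (rev s)); first by exists (rev s); rewrite //= size_rev.
  by rewrite -WE wordV ?opA_unit ?opB_unit // revK.
move=> n; split; [|exact: plus|exact: minus|exact: minus].
by rewrite -{1}HA1 -{1}GA1; exact: plus (symmetry1 Delta) W1.
Qed.
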